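(* (1) There is a saturated structure $\mathfrak A_{\mathrm{sat}}$ of cardinality $2^\omega$ such that $\mathrm{Inv}(\mathrm{Pol}^\omega(\mathfrak A_{\mathrm{sat}}))\neq\langle\mathfrak A_{\mathrm{sat}}\rangle_{\mathrm{pp}}$. (2) There is a saturated structure $\mathfrak A_{\mathrm{sat}}$ of cardinality $2^\omega$ such that $\mathrm{Inv}(\mathrm{Pol}(\mathfrak A_{\mathrm{sat}}))\cap\langle\mathfrak A_{\mathrm{sat}}\rangle_{\mathrm{fo}}\neq\langle\mathfrak A_{\mathrm{sat}}\rangle_{\mathrm{pp}}$. (3) There is a structure $\mathfrak A$ such that $\mathrm{Inv}(\mathrm{Pol}^\omega(\mathfrak A))\cap\langle\mathfrak A\rangle_{\mathrm{fo}}\neq\langle\mathfrak A\rangle_{\mathrm{pp}}$.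
   Context: Structures are over relational signatures (possibly with constants). $\langle\mathfrak A\rangle_{\mathrm{fo}}$, $\langle\mathfrak A\rangle_{\mathrm{pp}}$: relations on $A$ definable without parameters by first-order, resp. primitive positive formulas (built from atoms, equalities, $\bot$ using $\wedge,\exists$). $\mathrm{Pol}(\mathfrak A)$: homomorphisms $\mathfrak A^k\to\mathfrak A$ for finite $k$; $\mathrm{Pol}^\omega(\mathfrak A)$: homomorphisms $\mathfrak A^\kappa\to\mathfrak A$ for $\kappa\le\omega$ (direct powers). $\mathrm{Inv}(F)$: relations on $A$ preserved coordinatewise by all $f\in F$. An infinite structure $\mathfrak A$ is saturated if it is $|A|$-saturated: for every sequence of fewer than $|A|$ parameters, every set of first-order formulas in one free variable over them consistent with the theory of $\mathfrak A$ with these parameters named is realised in $A$. *)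

(* Defs.v *)
From Stdlib Require Import List.
From mathcomp Require Import all_boot.

Set Implicit Arguments.
Unset Strict Implicit.
Unset Printing Implicit Defensive.

Record signature := Signature {
  rsym  : Type;
  arity : rsym -> nat;
  csym  : Type
}.

Record structure (S : signature) := Structure {
  carrier : Type;
  rel : forall R : rsym S, ('I_(arity R) -> carrier) -> Prop;
  cst : csym S -> carrier
}.
Arguments carrier {S} _.
Arguments rel {S} _ R _.
Arguments cst {S} _ c.

(** * First-order formulas; variables are natural numbers, and the terms may
    also contain parameters from a type P (P = Empty_set: no parameters). *)
Inductive term (S : signature) (P : Type) :=
| TVar of nat
| TConst of csym S
| TPar of P.

Inductive formula (S : signature) (P : Type) :=
| FAtom (R : rsym S) of ('I_(arity R) -> term S P)
| FEq of term S P & term S P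
| FBot
| FNeg of formula S P
| FAnd of formula S P & formula S P
| FEx of nat & formula S P.

Arguments TVar {S P}.
Arguments TConst {S P}.
Arguments TPar {S P}.
Arguments FAtom {S P}.
Arguments FEq {S P}.
Arguments FBot {S P}.
Arguments FNeg {S P}.
Arguments FAnd {S P}.
Arguments FEx {S P}.

Section Semantics.
Variables (S : signature) (A : structure S) (P : Type) (pa : P -> carrier A).

Definition eval_term (e : nat -> carrier A) (t : term S P) : carrier A :=
  match t with
  | TVar n => e n
  | TConst c => cst A c
  | TPar p => pa p
  end.

Definition upd (e : nat -> carrier A) (n : nat) (a : carrier A) : nat -> carrier A :=
  fun k => if k == n then a else e k.

Fixpoint sat (e : nat -> carrier A) (phi : formula S P) : Prop :=
  match phi with
  | FAtom R args => rel A R (fun i => eval_term e (args i))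
  | FEq t1 t2 => eval_term e t1 = eval_term e t2
  | FBot => False
  | FNeg psi => ~ sat e psi
  | FAnd psi chi => sat e psi /\ sat e chi
  | FEx n psi => exists a, sat (upd e n a) psi
  end.
End Semantics.

Definition occurs_term S P (k : nat) (t : term S P) : Prop := t = TVar k.

Fixpoint free_in S P (k : nat) (phi : formula S P) : Prop :=
  match phi with
  | FAtom R args => exists i, occurs_term k (args i)
  | FEq t1 t2 => occurs_term k t1 \/ occurs_term k t2
  | FBot => False
  | FNeg psi => free_in k psi
  | FAnd psi chi => free_in k psi \/ free_in k chi
  | FEx n psi => k <> n /\ free_in k psi
  end.

Fixpoint is_pp S P (phi : formula S P) : Prop :=
  match phi with
  | FAtom _ _ | FEq _ _ | FBot => True
  | FNeg _ => False
  | FAnd psi chi => is_pp psi /\ is_pp chi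
  | FEx _ psi => is_pp psi
  end.

Definition no_params {T : Type} : Empty_set -> T := fun x => match x with end.

(** Definability without parameters of an n-ary relation (tuples indexed by
    'I_n, the i-th coordinate being assigned to variable i). *)
Definition fo_definable S (A : structure S) (n : nat)
    (Rel : ('I_n -> carrier A) -> Prop) : Prop :=
  exists phi : formula S Empty_set,
    (forall k, free_in k phi -> k < n) /\
    forall e : nat -> carrier A,
      Rel (fun i => e (nat_of_ord i)) <-> sat (A:=A) no_params e phi.

Definition pp_definable S (A : structure S) (n : nat)
    (Rel : ('I_n -> carrier A) -> Prop) : Prop :=
  exists phi : formula S Empty_set,
    is_pp phi /\
    (forall k, free_in k phi -> k < n) /\
    forall e : nat -> carrier A,
      Rel (fun i => e (nat_of_ord i)) <-> sat (A:=A) no_params e phi.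

Definition preserves {X : Type} (I : Type) (f : (I -> X) -> X) (n : nat)
    (Rel : ('I_n -> X) -> Prop) : Prop :=
  forall t : 'I_n -> I -> X,
    (forall i : I, Rel (fun j => t j i)) -> Rel (fun j => f (t j)).

Definition power_hom S (A : structure S) (I : Type)
    (f : (I -> carrier A) -> carrier A) : Prop :=
  (forall R : rsym S, preserves f (rel A R)) /\
  (forall c : csym S, f (fun _ => cst A c) = cst A c).

(** Pol(A): homomorphisms A^k -> A, k finite (k >= 1);
    Pol^omega(A): homomorphisms A^kappa -> A, 1 <= kappa <= omega. *)
Definition in_Pol S (A : structure S) (k : nat)
    (f : ('I_k -> carrier A) -> carrier A) : Prop :=
  0 < k /\ power_hom f.

Definition in_Pol_omega_infinite S (A : structure S)
    (f : (nat -> carrier A) -> carrier A) : Prop := power_hom f.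

Definition in_Inv_Pol S (A : structure S) (n : nat)
    (Rel : ('I_n -> carrier A) -> Prop) : Prop :=
  forall (k : nat) (f : ('I_k -> carrier A) -> carrier A),
    in_Pol f -> preserves f Rel.

Definition in_Inv_Pol_omega S (A : structure S) (n : nat)
    (Rel : ('I_n -> carrier A) -> Prop) : Prop :=
  in_Inv_Pol Rel /\
  forall f : (nat -> carrier A) -> carrier A,
    in_Pol_omega_infinite f -> preserves f Rel.

Definition card_lt (X Y : Type) : Prop :=
  (exists g : X -> Y, injective g) /\ ~ (exists h : Y -> X, injective h).

Definition is_infinite (X : Type) : Prop := exists g : nat -> X, injective g.

Definition has_card_continuum (X : Type) : Prop :=
  exists f : X -> (nat -> bool), bijective f.

Definition finitely_satisfiable S (A : structure S) (P : Type)
    (pa : P -> carrier A) (Sigma : formula S P -> Prop) : Prop :=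
  forall l : list (formula S P), (forall phi, In phi l -> Sigma phi) ->
    exists a : carrier A, forall phi, In phi l -> sat (A:=A) pa (fun _ => a) phi.

(** |A|-saturated: for every set X of parameters of cardinality < |A|, every set
    of formulas in the single free variable 0 over X which is consistent with
    Th(A, X) (i.e. finitely satisfiable in A) is realised in A. *)
Definition saturated S (A : structure S) : Prop :=
  is_infinite (carrier A) /\
  forall (X : carrier A -> Prop),
    card_lt {x : carrier A | X x} (carrier A) ->
    forall Sigma : formula S {x : carrier A | X x} -> Prop,
      (forall phi, Sigma phi -> forall k, free_in k phi -> k = 0) ->
      finitely_satisfiable (@proj1_sig _ X) Sigma ->
      exists a : carrier A,
        forall phi, Sigma phi -> sat (A:=A) (@proj1_sig _ X) (fun _ => a) phi.

(* Main.v *)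
(* A pp-formula mentions only finitely many symbols, and its satisfaction is
   preserved by any homomorphism from a power that fixes the constants.  Each
   part exhibits a relation of the required kind together with a map that is a
   homomorphism for the symbols of any candidate pp-definition but does not
   preserve the relation.  In (1) and (2) elements are pairs (label, tag) of
   points of Cantor space and relations read finite prefixes of labels;
   compactness of Cantor space and a back-and-forth argument over the tags give
   saturation.  In (3) elements are subsets of Cantor space ordered by
   inclusion "up to uncountable sets", and countability is destroyed only by
   unions of uncountably many sets. *)

Require Import Defs.
From Stdlib Require Import List Classical ClassicalEpsilon.
From Stdlib Require Import FunctionalExtensionality PropExtensionality.
From mathcomp Require Import all_boot.

Set Implicit Arguments.
Unset Strict Implicit.
Unset Printing Implicit Defensive.

Section PpPreservation.
Variables (S : signature) (A : structure S) (P : Type) (pa : P -> carrier A).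
(* [i0] is needed for [FBot]: over the empty power every formula holds pointwise. *)
Variables (I : Type) (i0 : I) (f : (I -> carrier A) -> carrier A).

Fixpoint preserves_atoms (phi : formula S P) : Prop :=
  match phi with
  | FAtom R _ => preserves f (Defs.rel A R)
  | FNeg psi | FEx _ psi => preserves_atoms psi
  | FAnd psi chi => preserves_atoms psi /\ preserves_atoms chi
  | _ => True
  end.

Hypothesis f_cst : forall c, f (fun _ => cst A c) = cst A c.
Hypothesis f_par : forall p, f (fun _ => pa p) = pa p.

Lemma eval_term_pointwise (t : nat -> I -> carrier A) tm :
  eval_term pa (fun n => f (t n)) tm = f (fun i => eval_term pa (fun n => t n i) tm).
Proof. by case: tm => [v|c|p] /=; rewrite ?f_cst ?f_par. Qed.

Lemma sat_pp_pointwise phi : is_pp phi -> preserves_atoms phi ->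
  forall t : nat -> I -> carrier A,
    (forall i, sat pa (fun n => t n i) phi) -> sat pa (fun n => f (t n)) phi.
Proof.
elim: phi => [R args|t1 t2||psi _|psi IHpsi chi IHchi|m psi IH] //= pp_phi f_atoms t sat_t.
- have -> : (fun j => eval_term pa (fun n => f (t n)) (args j)) =
            (fun j => f (fun i => eval_term pa (fun n => t n i) (args j))).
    by apply: functional_extensionality => j; rewrite eval_term_pointwise.
  exact: f_atoms.
- by rewrite !eval_term_pointwise; congr f; apply: functional_extensionality.
- case: pp_phi f_atoms => [pp_psi pp_chi] [f_psi f_chi].
  by split; [apply: IHpsi => // i; case: (sat_t i) | apply: IHchi => // i; case: (sat_t i)].
- have [a sat_a] : exists a : I -> carrier A,
      forall i, sat pa (upd (fun n => t n i) m (a i)) psi.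
    exact: (ClassicalEpsilon.choice (fun i a => sat pa (upd (fun n => t n i) m a) psi)).
  exists (f a).
  pose t' n := if n == m then a else t n.
  have -> : upd (fun n => f (t n)) m (f a) = (fun n => f (t' n)).
    by apply: functional_extensionality => n; rewrite /upd /t'; case: (n == m).
  apply: IH => // i; rewrite (_ : (fun n => t' n i) = upd (fun n => t n i) m (a i)) //.
  by apply: functional_extensionality => n; rewrite /upd /t'; case: (n == m).
Qed.

End PpPreservation.

Lemma preserves_atoms_hom S (A : structure S) P I (f : (I -> carrier A) -> carrier A) :
  power_hom f -> forall phi : formula S P, preserves_atoms f phi.
Proof. by case=> f_rel _; elim=> //= *; tauto. Qed.

Definition defines S (A : structure S) n (phi : formula S Empty_set)
    (Rel : ('I_n -> carrier A) -> Prop) : Prop :=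
  forall e : nat -> carrier A, Rel (fun i => e (nat_of_ord i)) <-> sat no_params e phi.

Lemma pp_defined_preserved S (A : structure S) n (Rel : ('I_n -> carrier A) -> Prop)
    phi (a0 : carrier A) I (i0 : I) (f : (I -> carrier A) -> carrier A) :
  is_pp phi -> defines phi Rel -> (forall c, f (fun _ => cst A c) = cst A c) ->
  preserves_atoms f phi -> preserves f Rel.
Proof.
move=> pp_phi phi_Rel f_cst f_atoms t Rel_t.
pose e m := if insub m is Some j then t j else fun _ : I => a0.
have eE (j : 'I_n) : e j = t j by rewrite /e valK.
have -> : (fun j => f (t j)) = (fun j : 'I_n => f (e j)).
  by apply: functional_extensionality => j; rewrite eE.
apply/(phi_Rel (fun m => f (e m)))/sat_pp_pointwise => // i.
apply/(phi_Rel (fun m => e m i)).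
rewrite (_ : (fun j : 'I_n => e j i) = (fun j => t j i)) //.
by apply: functional_extensionality => j; rewrite eE.
Qed.

Definition cantor := nat -> bool.

Section CantorCompactness.
Variables (F : Type) (Sigma : F -> Prop) (D : F -> cantor -> Prop) (bound : F -> nat).
Hypothesis D_local : forall phi l l',
  (forall n, n < bound phi -> l n = l' n) -> D phi l -> D phi l'.

Definition extendable (q : cantor) (k : nat) : Prop :=
  forall Psi : list F, (forall phi, In phi Psi -> Sigma phi) ->
    exists l, (forall i, i < k -> l i = q i) /\ forall phi, In phi Psi -> D phi l.

Definition set_bit (q : cantor) (k : nat) (b : bool) : cantor :=
  fun i => if i == k then b else q i.

Lemma extendable_step q k : extendable q k ->
  extendable (set_bit q k false) k.+1 \/ extendable (set_bit q k true) k.+1.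
Proof.
move=> ext_q; apply: NNPP => /not_or_and[not_ext0 not_ext1].
have [Psi0 not_Psi0] := not_all_ex_not _ _ not_ext0.
have [Psi1 not_Psi1] := not_all_ex_not _ _ not_ext1.
have [Sigma0 none0] := imply_to_and _ _ not_Psi0.
have [Sigma1 none1] := imply_to_and _ _ not_Psi1.
have [|l [l_q D_l]] := ext_q (Psi0 ++ Psi1).
  by move=> phi /(in_app_or Psi0 Psi1 phi)[]; [apply: Sigma0 | apply: Sigma1].
have l_ext i : i < k.+1 -> l i = set_bit q k (l k) i.
  by rewrite ltnS leq_eqVlt /set_bit; case: eqP => [->|_] //= /l_q.
case l_k: (l k) l_ext => l_ext.
- by apply: none1; exists l; split=> // phi ?; apply: D_l; apply: in_or_app; right.
- by apply: none0; exists l; split=> // phi ?; apply: D_l; apply: in_or_app; left.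
Qed.

Fixpoint branch (k : nat) : cantor :=
  if k is k'.+1 then
    let q := branch k' in
    set_bit q k'
      (if excluded_middle_informative (extendable (set_bit q k' false) k)
       then false else true)
  else fun _ => false.

Lemma extendable_branch : extendable (branch 0) 0 -> forall k, extendable (branch k) k.
Proof.
move=> ext0; elim=> // k IH /=.
by case: excluded_middle_informative => //; case: (extendable_step IH).
Qed.

Lemma branch_stable k m i : i < k -> k <= m -> branch m i = branch k i.
Proof.
move=> i_k; elim: m => [|m IH]; first by rewrite leqn0 => /eqP ->.
rewrite leq_eqVlt => /orP [/eqP <- //|]; rewrite ltnS => k_m.
by rewrite /= /set_bit ifN ?IH // neq_ltn (leq_trans i_k k_m).
Qed.

Theorem cantor_compact :
  (forall Psi : list F, (forall phi, In phi Psi -> Sigma phi) ->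
    exists l, forall phi, In phi Psi -> D phi l) ->
  exists l, forall phi, Sigma phi -> D phi l.
Proof.
move=> fin_sat.
have ext0 : extendable (branch 0) 0.
  by move=> Psi /fin_sat [l D_l]; exists l.
exists (fun i => branch i.+1 i) => phi Sigma_phi.
have [|l [l_branch D_l]] := @extendable_branch ext0 (bound phi) [:: phi].
  by move=> psi [<-|[]].
apply: (D_local (l := l)); last by apply: D_l; left.
by move=> n n_lt; rewrite l_branch // (branch_stable (k := n.+1)).
Qed.

End CantorCompactness.

Lemma realized_in_list (F X : Type) (Sat : F -> X -> Prop) (Sigma : F -> Prop)
    (G : list X) (Psi : list F) :
  (forall phi, In phi Psi -> Sigma phi) ->
  (forall a, (forall phi, In phi Psi -> Sat phi a) -> In a G) ->
  (forall Psi', (forall phi, In phi Psi' -> Sigma phi) ->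
     exists a, forall phi, In phi Psi' -> Sat phi a) ->
  exists a, forall phi, Sigma phi -> Sat phi a.
Proof.
move=> + + fin_sat; elim: G Psi => [|x G IH] Psi Psi_Sigma Psi_in_G.
  by have [a /Psi_in_G] := fin_sat Psi Psi_Sigma.
case: (classic (forall phi, Sigma phi -> Sat phi x)) => [x_sat|x_unsat]; first by exists x.
have [phi phi_fails] := not_all_ex_not _ _ x_unsat.
have [Sigma_phi not_sat] := imply_to_and _ _ phi_fails.
apply: (IH (phi :: Psi)) => [psi [<-|/Psi_Sigma]|a sat_a] //.
have [x_a|] := Psi_in_G a (fun psi psi_Psi => sat_a psi (or_intror psi_Psi)); last by [].
by case: not_sat; rewrite x_a; apply: sat_a; left.
Qed.

Definition interleave (p : cantor * cantor) : cantor :=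
  fun n => if odd n then p.2 n./2 else p.1 n./2.
Definition deinterleave (u : cantor) : cantor * cantor :=
  (fun m => u m.*2, fun m => u m.*2.+1).

Lemma interleaveK : cancel interleave deinterleave.
Proof.
case=> a b; rewrite /interleave /deinterleave /=.
by congr pair; apply: functional_extensionality => m;
  rewrite /= odd_double ?half_double ?uphalf_double.
Qed.

Lemma deinterleaveK : cancel deinterleave interleave.
Proof.
move=> u; apply: functional_extensionality => n; rewrite /interleave /deinterleave /=.
by case odd_n: (odd n); congr u; rewrite -[RHS](odd_double_half n) odd_n.
Qed.

Lemma cantor_pair_continuum : has_card_continuum (cantor * cantor).
Proof. by exists interleave, deinterleave; [exact: interleaveK | exact: deinterleaveK]. Qed.

Lemma small_set_misses_label_class (X : cantor * cantor -> Prop) :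
  card_lt {x | X x} (cantor * cantor) -> forall l, exists c, c.1 = l /\ ~ X c.
Proof.
move=> [_ no_inj] l; apply: NNPP => class_in_X; apply: no_inj.
have X_l u : X (l, u) by apply: NNPP => ?; apply: class_in_X; exists (l, u).
exists (fun z => exist X (l, interleave z) (X_l _)) => z z' [].
exact: (can_inj interleaveK).
Qed.

Lemma exists_fresh_label (l : cantor) (h : nat -> cantor * cantor) :
  exists a, a.1 = l /\ forall m, a <> h m.
Proof.
exists (l, fun m => ~~ (h m).2 m); split=> // m /(congr1 (fun z => z.2 m)) /=.
by case: ((h m).2 m).
Qed.

Section LabelStructure.
Variables (rs : Type) (ar : rs -> nat).
Variables (interp : forall r, ('I_(ar r) -> cantor) -> Prop) (bd : rs -> nat).
Hypothesis interp_local : forall r (l l' : 'I_(ar r) -> cantor),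
  (forall i n, n < bd r -> l i n = l' i n) -> interp l -> interp l'.

Definition label_sig := @Signature rs ar Empty_set.

(* An element is a pair (label, tag).  The relations only read finite prefixes
   of the labels; the tags make every label class of size continuum. *)
Definition label_struct : structure label_sig :=
  @Structure label_sig (cantor * cantor) (fun r t => interp (fun i => (t i).1))
    (fun c => match c with end).

Local Notation elt := (carrier label_struct).

Section Agreement.
Context {P : Type} (pa : P -> elt).

Fixpoint label_bound (phi : formula label_sig P) : nat :=
  match phi with
  | FAtom r _ => bd r
  | FNeg psi | FEx _ psi => label_bound psi
  | FAnd psi chi => maxn (label_bound psi) (label_bound chi)
  | _ => 0
  end.

Definition term_params (t : term label_sig P) : list P :=
  if t is TPar p then [:: p] else [::].

Fixpoint params (phi : formula label_sig P) : list P :=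
  match phi with
  | FAtom r args => flat_map (fun i => term_params (args i)) (enum 'I_(ar r))
  | FEq t1 t2 => term_params t1 ++ term_params t2
  | FNeg psi | FEx _ psi => params psi
  | FAnd psi chi => params psi ++ params chi
  | FBot => [::]
  end.

Definition agree N (L : list P) (e e' : nat -> elt) : Prop :=
  [/\ forall i j, e i = e j <-> e' i = e' j,
      forall i p, In p L -> (e i = pa p <-> e' i = pa p)
    & forall i n, n < N -> (e i).1 n = (e' i).1 n].

Lemma agree_sym N L e e' : agree N L e e' -> agree N L e' e.
Proof. by case=> eq_e par_e lab_e; split=> *; rewrite ?eq_e ?par_e ?lab_e. Qed.

Lemma agree_upd N L e e' m x x' : agree N L e e' ->
  (forall j, j <> m -> (x = e j <-> x' = e' j)) ->
  (forall p, In p L -> (x = pa p <-> x' = pa p)) ->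
  (forall n, n < N -> x.1 n = x'.1 n) ->
  agree N L (upd e m x) (upd e' m x').
Proof.
case=> eq_e par_e lab_e eq_x par_x lab_x; rewrite /upd; split.
- move=> i j; case: eqP => i_m; case: eqP => j_m //; first exact: eq_x.
  by split=> /esym /(eq_x i i_m) /esym.
- by move=> i p p_L; case: eqP => _; [exact: par_x | exact: par_e].
- by move=> i n n_N; case: eqP => _; [exact: lab_x | exact: lab_e].
Qed.

(* Back-and-forth: an element new on the left is matched by a fresh element
   with the same label. *)
Lemma agree_extend N L e e' m x : agree N L e e' ->
  exists x', agree N L (upd e m x) (upd e' m x').
Proof.
move=> agr; case: (agr) => eq_e par_e lab_e.
case: (classic (exists j, j <> m /\ e j = x)) => [[j [j_m <-]]|new_var].
  exists (e' j); apply: (agree_upd agr) => [k _|p|n];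
    [exact: eq_e | exact: par_e | exact: lab_e].
case: (classic (exists p, In p L /\ pa p = x)) => [[p [p_L <-]]|new_par].
  exists (pa p); apply: (agree_upd agr) => // k _.
  by split=> /esym /(par_e k p p_L) /esym.
(* [h] enumerates the parameters in [L], followed by the values of [e']. *)
pose h k := List.nth k (map pa L) (e' (k - length L)).
have [x' [lab_x' fresh_x']] := exists_fresh_label x.1 h.
exists x'; apply: (agree_upd agr) => [j j_m|p p_L|n _]; last by rewrite lab_x'.
  split=> [x_ej|x'_ej]; first by case: new_var; exists j.
  case: (fresh_x' (j + length L)); rewrite /h List.nth_overflow ?addnK //.
  by rewrite List.length_map; apply/leP; rewrite leq_addl.
split=> [x_p|x'_p]; first by case: new_par; exists p.
have [k [k_lt nth_k]] := List.In_nth (map pa L) (pa p) (e' 0) (in_map pa L p p_L).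
by case: (fresh_x' k); rewrite x'_p -nth_k /h; apply: List.nth_indep.
Qed.

Lemma eval_term_agree_label N L e e' t n : agree N L e e' -> n < N ->
  (eval_term pa e t).1 n = (eval_term pa e' t).1 n.
Proof. by case: t => [v|[]|p] // [_ _ lab_e]; exact: lab_e. Qed.

Lemma eval_term_agree_eq N L e e' t1 t2 :
  incl (term_params t1 ++ term_params t2) L -> agree N L e e' ->
  eval_term pa e t1 = eval_term pa e t2 -> eval_term pa e' t1 = eval_term pa e' t2.
Proof.
move=> params_L [eq_e par_e _].
case: t1 params_L => [v|[]|p]; case: t2 => [w|[]|q] //= params_L.
- exact: (proj1 (eq_e v w)).
- by apply: (proj1 (par_e v q _)); apply: params_L; left.
- by move/esym/(par_e w p (params_L p (or_introl erefl)))/esym.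
Qed.

Lemma sat_agree N L phi : label_bound phi <= N -> incl (params phi) L ->
  forall e e', agree N L e e' -> sat pa e phi -> sat pa e' phi.
Proof.
elim: phi => [r args|t1 t2||psi IH|psi IHpsi chi IHchi|m psi IH] /=
  bound_N params_L e e' agr.
- apply: interp_local => i n n_bd; apply: eval_term_agree_label agr _.
  exact: leq_trans n_bd bound_N.
- exact: (eval_term_agree_eq params_L agr).
- by [].
- by move=> not_e sat_e'; apply/not_e/(IH bound_N params_L e' e (agree_sym agr)).
- rewrite geq_max in bound_N; case/andP: bound_N => psi_N chi_N [sat_psi sat_chi].
  split; [apply: (IHpsi psi_N _ e) sat_psi | apply: (IHchi chi_N _ e) sat_chi] => //.
  + by move=> p p_in; apply: params_L; apply: in_or_app; left.
  + by move=> p p_in; apply: params_L; apply: in_or_app; right.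
- move=> [x sat_x]; have [x' agr_x] := agree_extend m x agr.
  by exists x'; apply: IH agr_x sat_x.
Qed.

Lemma sat_const_label phi a b :
  (forall n, n < label_bound phi -> a.1 n = b.1 n) ->
  (forall p, In p (params phi) -> a <> pa p /\ b <> pa p) ->
  sat pa (fun _ => a) phi -> sat pa (fun _ => b) phi.
Proof.
move=> lab_ab par_ab; apply: (sat_agree (N := label_bound phi) (L := params phi)) => //.
by split=> // i p /par_ab [a_p b_p]; split.
Qed.

Lemma preserves_atoms_below I (g : (I -> elt) -> elt) N :
  (forall r, bd r <= N -> preserves g (Defs.rel label_struct r)) ->
  forall phi : formula label_sig P, label_bound phi <= N -> preserves_atoms g phi.
Proof.
move=> g_rel; elim=> //= [r _|psi IHpsi chi IHchi]; first exact: g_rel.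
by rewrite geq_max => /andP[/IHpsi ? /IHchi ?].
Qed.

End Agreement.

Theorem label_struct_saturated : saturated label_struct.
Proof.
split.
  exists (fun n => (fun _ => false, fun m => m == n) : elt) => n n'.
  by move/(congr1 (fun z : elt => z.2 n)); rewrite /= eqxx => /esym/eqP.
move=> X small_X Sigma _ fin_sat; pose pa := proj1_sig (P := X).
have [c c_spec] : exists c : cantor -> elt, forall l, (c l).1 = l /\ ~ X (c l).
  exact: (ClassicalEpsilon.choice _ (small_set_misses_label_class small_X)).
have c_par l p : c l <> pa p.
  by case: (c_spec l) => _ c_X c_p; apply: c_X; rewrite c_p; exact: proj2_sig.
case: (classic (exists l, forall phi, Sigma phi -> sat pa (fun _ => c l) phi)).
  by case=> l sat_l; exists (c l).
move=> no_label.
have [Psi [Psi_Sigma Psi_no_label]] : exists Psi, (forall phi, In phi Psi -> Sigma phi) /\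
    forall l, ~ forall phi, In phi Psi -> sat pa (fun _ => c l) phi.
  apply: NNPP => all_label; apply: no_label.
  apply: (@cantor_compact _ Sigma (fun phi l => sat pa (fun _ => c l) phi) label_bound)
    => [phi l l' l_l'|Psi Psi_Sigma].
    apply: (@sat_const_label _ pa phi (c l) (c l')) => [n /l_l'|p _].
      by case: (c_spec l) => -> _; case: (c_spec l') => -> _.
    by split; apply: c_par.
  apply: NNPP => no_l; apply: all_label; exists Psi; split=> // l sat_l.
  by apply: no_l; exists l.
apply: (realized_in_list (G := map pa (flat_map params Psi)) Psi_Sigma) => // a sat_a.
apply: NNPP => a_not_par; apply: (Psi_no_label a.1) => phi phi_Psi.
apply: (@sat_const_label _ pa phi a (c a.1)) (sat_a phi phi_Psi) => [n _|p p_phi].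
  by case: (c_spec a.1) => ->.
split; last exact: c_par.
move=> a_p; apply: a_not_par; rewrite a_p; apply: in_map; apply/in_flat_map.
by exists phi.
Qed.

End LabelStructure.

Definition bit_agree (n : nat) (l : 'I_2 -> cantor) : Prop := l ord0 n = l ord_max n.

Lemma bit_agree_local n (l l' : 'I_2 -> cantor) :
  (forall i m, m < n.+1 -> l i m = l' i m) -> bit_agree n l -> bit_agree n l'.
Proof. by move=> l_l'; rewrite /bit_agree -!l_l'. Qed.

Definition bit_agree_struct := @label_struct nat (fun _ => 2) bit_agree.

Definition same_label (t : 'I_2 -> carrier bit_agree_struct) : Prop :=
  forall n, (t ord0).1 n = (t ord_max).1 n.

Lemma same_label_preserved I
    (f : (I -> carrier bit_agree_struct) -> carrier bit_agree_struct) :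
  power_hom f -> preserves f same_label.
Proof. by case=> f_rel _ t t_same n; apply: (f_rel n t) => i; exact: t_same. Qed.

(* A pp-definition mentions only the relations [bit_agree n] with [n < N]; the
   unary map copying the tag into label bit [N] preserves them, but not [same_label]. *)
Lemma same_label_not_pp_definable : ~ pp_definable same_label.
Proof.
move=> [phi [pp_phi [_ phi_def]]].
pose N := label_bound (fun n : nat => n.+1) phi.
pose g (s : unit -> carrier bit_agree_struct) : carrier bit_agree_struct :=
  (fun m => if m == N then (s tt).2 0 else (s tt).1 m, (s tt).2).
pose tau (j : 'I_2) (_ : unit) : carrier bit_agree_struct :=
  (fun _ => false, fun _ => val j == 1).
have : same_label (fun j => g (tau j)).
  apply: (pp_defined_preserved (tau ord0 tt) tt pp_phi phi_def) => [[]||[] n] //.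
  apply: (preserves_atoms_below (bd := succn) (N := N)) => // r r_N t t_agree.
  have /negbTE r_N' : r != N by rewrite neq_ltn r_N.
  by rewrite /= /bit_agree /= !r_N'; exact: t_agree tt.
by move/(_ N); rewrite /= eqxx.
Qed.

Definition avoids (r : nat * cantor) (l : 'I_1 -> cantor) : Prop :=
  l ord0 0 = true /\ exists2 j, j < r.1 & l ord0 j.+1 <> r.2 j.

Lemma avoids_local r (l l' : 'I_1 -> cantor) :
  (forall i n, n < r.1.+1 -> l i n = l' i n) -> avoids r l -> avoids r l'.
Proof.
move=> l_l' [l_0 [j j_lt l_j]]; split; first by rewrite -l_l'.
by exists j => //; rewrite -l_l'.
Qed.

Definition avoids_struct := @label_struct (nat * cantor) (fun _ => 1) avoids.

Definition head_true (t : 'I_1 -> carrier avoids_struct) : Prop := (t ord0).1 0 = true.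

(* [head_true x] iff [x] avoids [(1, fun _ => true)] or [(1, fun _ => false)]. *)
Lemma head_true_fo_definable : fo_definable head_true.
Proof.
pose x0 (_ : 'I_1) := @TVar (label_sig (fun _ : nat * cantor => 1)) Empty_set 0.
pose avoids_const (b : bool) :=
  FAtom ((1, fun _ => b) : rsym (label_sig (fun _ : nat * cantor => 1))) x0.
exists (FNeg (FAnd (FNeg (avoids_const true)) (FNeg (avoids_const false)))); split.
  by move=> k /= [[i [<-]]|[i [<-]]].
move=> e; rewrite /head_true /= /avoids /=; split.
  move=> head_e [not_avoid_true not_avoid_false].
  by case e_1: ((e 0).1 1); [apply: not_avoid_false | apply: not_avoid_true];
    split=> //; exists 0 => //; rewrite e_1.
by move=> not_both; apply: NNPP => head_e; apply: not_both; split=> -[].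
Qed.

(* The coordinates of a [k]-tuple all avoid [(k, s)] for the diagonal sequence [s]. *)
Lemma head_true_in_Inv_Pol : in_Inv_Pol head_true.
Proof.
move=> [|k] f [k_pos [f_rel _]] t t_head //.
pose s (m : nat) := ~~ (t ord0 (inord m)).1 m.+1.
suff [] : avoids (k.+1, s) (fun j => (f (t j)).1) by [].
apply: (f_rel (k.+1, s) t) => i; split; first exact: t_head.
by exists (val i) => //=; rewrite /s inord_val; case: ((t ord0 i).1 i.+1).
Qed.

(* The family [true :: s], [s] ranging over Cantor space, avoids no single
   [(k, s')] (take [s = s']), so this homomorphism from the power of size
   continuum maps it outside [head_true]. *)
Lemma head_true_not_pp_definable : ~ pp_definable head_true.
Proof.
move=> [phi [pp_phi [_ phi_def]]].
pose z0 : carrier avoids_struct := (fun _ => false, fun _ => false).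
pose common (s : cantor -> carrier avoids_struct) :=
  exists r, forall i, avoids r (fun _ => (s i).1).
pose f (s : cantor -> carrier avoids_struct) : carrier avoids_struct :=
  if excluded_middle_informative (common s) then s (fun _ => false) else z0.
pose tau (_ : 'I_1) (s : cantor) : carrier avoids_struct :=
  (fun m => if m is m'.+1 then s m' else true, fun _ => false).
have : head_true (fun j => f (tau j)).
  apply: (pp_defined_preserved z0 (fun _ => false) pp_phi phi_def) => //.
  apply: preserves_atoms_hom; split=> [r t t_r|[]].
  have -> : (fun j => f (t j)) = (fun _ => f (t ord0)).
    by apply: functional_extensionality => j; rewrite (ord1 j).
  rewrite /f; case: (excluded_middle_informative (common (t ord0))) => [_|no_common] /=.
    exact: t_r.
  by case: no_common; exists r; exact: t_r.
rewrite /head_true /f.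
case: (excluded_middle_informative (common (tau ord0))) => [[[k s] all_avoid]|] //=.
by have [_ [j _]] := all_avoid s.
Qed.

Definition countable_set (X : cantor -> Prop) : Prop :=
  exists g : cantor -> nat, forall a b, X a -> X b -> g a = g b -> a = b.

Lemma countable_subset (X Y : cantor -> Prop) :
  countable_set Y -> (forall z, X z -> Y z) -> countable_set X.
Proof. by move=> [g g_inj] X_Y; exists g => a b /X_Y ? /X_Y; apply: g_inj. Qed.

Lemma cantor_uncountable : ~ countable_set (fun _ => True).
Proof.
move=> [g g_inj].
have [enum enumK] : exists enum : nat -> cantor, forall x, enum (g x) = x.
  exists (fun m => if excluded_middle_informative (exists x, g x = m)
                  then epsilon (inhabits (fun _ => false)) (fun x => g x = m)
                  else fun _ => false) => x.
  case: excluded_middle_informative => [ex_m|]; last by case; exists x.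
  by apply: g_inj => //; exact: epsilon_spec ex_m.
pose d m := ~~ enum m m.
by have := congr1 (fun s => s (g d)) (enumK d); rewrite /= /d; case: (enum (g d) (g d)).
Qed.

Lemma countable_union I (iota : I -> nat) (F : I -> cantor -> Prop) :
  injective iota -> (forall i, countable_set (F i)) ->
  countable_set (fun y => exists i, F i y).
Proof.
move=> iota_inj /(ClassicalEpsilon.choice
  (fun i g => forall a b, F i a -> F i b -> g a = g b -> a = b)) [g g_inj].
case: (classic (inhabited I)) => [[i0]|no_I]; last first.
  by exists (fun _ => 0) => a b [i]; case: no_I.
have [idx idx_F] : exists idx : cantor -> I, forall y, (exists i, F i y) -> F (idx y) y.
  apply: (ClassicalEpsilon.choice (fun y i => (exists i, F i y) -> F i y)) => y.
  by case: (classic (exists i, F i y)) => [[i F_i]|none]; [exists i | exists i0].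
exists (fun y => pickle (iota (idx y), g (idx y) y)) => a b /idx_F F_a /idx_F F_b.
move/(pcan_inj pickleK) => [/iota_inj idx_ab].
by move: F_a; rewrite idx_ab => F_a; apply: g_inj.
Qed.

Definition below (x y : cantor -> Prop) : Prop :=
  (forall z, x z -> y z) \/ ~ countable_set y.

Definition below_sig := @Signature unit (fun _ => 2) {X : cantor -> Prop | countable_set X}.

Definition below_struct : structure below_sig :=
  @Structure below_sig (cantor -> Prop) (fun _ t => below (t ord0) (t ord_max))
    (@proj1_sig _ _).

Definition countable_rel (t : 'I_1 -> carrier below_struct) : Prop :=
  countable_set (t ord0).

(* A countable family of countable sets lies [below] the constant naming its union. *)
Lemma countable_rel_preserved I (iota : I -> nat)
    (f : (I -> carrier below_struct) -> carrier below_struct) :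
  injective iota -> power_hom f -> preserves f countable_rel.
Proof.
move=> iota_inj [f_rel f_cst] t t_cnt.
have U_cnt : countable_set (fun y => exists i, t ord0 i y).
  exact: countable_union iota_inj _.
pose U : csym below_sig := exist _ _ U_cnt.
have : below (f (t ord0)) (cst below_struct U).
  rewrite -(f_cst U).
  apply: (f_rel tt (fun j => if val j == 0 then t ord0 else fun _ => cst below_struct U)).
  by move=> i; left=> z t_z; exists i.
by case=> [t_U|]; [exact: countable_subset U_cnt t_U | case].
Qed.

(* [x] is countable iff the full set is not [below] it. *)
Lemma countable_rel_fo_definable : fo_definable countable_rel.
Proof.
pose args (j : 'I_2) := @TVar below_sig Empty_set (if val j == 0 then 1 else 0).
exists (FEx 1 (FNeg (FAtom (tt : rsym below_sig) args))); split.
  move=> k /= [+ [i]]; rewrite /occurs_term /args => k_1 [k_i].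
  by move: k_1; rewrite -k_i; case: (val i == 0).
move=> e; rewrite /countable_rel /= /below /upd /=; split.
  move=> e_cnt; exists (fun _ => True) => -[full_e|]; last by [].
  by apply: cantor_uncountable; exact: countable_subset e_cnt full_e.
by move=> [y not_below]; apply: NNPP => not_cnt; apply: not_below; right.
Qed.

(* The union of a continuum-indexed family is a homomorphism from the power of
   size continuum, and it maps the singletons to the whole space. *)
Lemma countable_rel_not_pp_definable : ~ pp_definable countable_rel.
Proof.
move=> [phi [pp_phi [_ phi_def]]].
pose f (s : cantor -> carrier below_struct) : carrier below_struct :=
  fun y => exists x, s x y.
have f_cst (X : cantor -> Prop) : f (fun _ => X) = X.
  apply: functional_extensionality => y; apply: propositional_extensionality.
  by split=> [[]|X_y] //; exists (fun _ => false).
have : countable_rel (fun _ => f (fun x y => y = x)).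
  apply: (pp_defined_preserved (A := below_struct) (fun _ => True) (fun _ => false) (f := f)
            pp_phi phi_def) => [c||x]; first exact: f_cst.
    apply: (preserves_atoms_hom (f := f)); split=> [[] t t_below|c]; last exact: f_cst.
    case: (classic (countable_set (f (t ord_max)))) => [cnt_max|]; last by right.
    left=> z [x t_x]; exists x; case: (t_below x) => [|not_cnt]; first exact.
    by case: not_cnt; apply: (countable_subset cnt_max) => w ?; exists x.
  by exists (fun _ => 0) => a b -> ->.
by move=> cnt; apply: cantor_uncountable; apply: (countable_subset cnt) => y _; exists y.
Qed.

Theorem proposition5 :
  (* (1) *)
  (exists (S : signature) (A : structure S),
      saturated A /\ has_card_continuum (carrier A) /\
      ~ (forall (n : nat) (Rel : ('I_n -> carrier A) -> Prop),
            in_Inv_Pol_omega Rel <-> pp_definable Rel)) /\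
  (* (2) *)
  (exists (S : signature) (A : structure S),
      saturated A /\ has_card_continuum (carrier A) /\
      ~ (forall (n : nat) (Rel : ('I_n -> carrier A) -> Prop),
            (in_Inv_Pol Rel /\ fo_definable Rel) <-> pp_definable Rel)) /\
  (* (3) *)
  (exists (S : signature) (A : structure S),
      ~ (forall (n : nat) (Rel : ('I_n -> carrier A) -> Prop),
            (in_Inv_Pol_omega Rel /\ fo_definable Rel) <-> pp_definable Rel)).
Proof.
split; [|split].
- exists (label_sig (fun _ : nat => 2)), bit_agree_struct.
  split; first exact: (label_struct_saturated bit_agree_local).
  split=> [|equiv]; first exact: cantor_pair_continuum.
  apply: same_label_not_pp_definable; apply/equiv.
  by split=> [k f [_ f_hom]|f f_hom]; apply: same_label_preserved.
- exists (label_sig (fun _ : nat * cantor => 1)), avoids_struct.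
  split; first exact: (label_struct_saturated avoids_local).
  split=> [|equiv]; first exact: cantor_pair_continuum.
  apply: head_true_not_pp_definable; apply/equiv.
  by split; [exact: head_true_in_Inv_Pol | exact: head_true_fo_definable].
- exists below_sig, below_struct => equiv.
  apply: countable_rel_not_pp_definable; apply/equiv.
  split; last exact: countable_rel_fo_definable.
  split=> [k f [_ f_hom]|f f_hom].
  + exact: (countable_rel_preserved val_inj).
  + exact: (countable_rel_preserved (iota := id)).
Qed.
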